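(* Let $X$ be a dart in $\mathbb{R}^n$ and let $d>1$. If $X\,|\,dX$ (that is, $X$ divides $dX$), then $g_{X,f}(s)\ge g_{X,f}(ds)$ for all payoff functions $f$ on $\mathbb{R}^n$ and all $s>0$. In particular, if $X$ is selfdecomposable, then $X$ is reasonable.
   Context: A dart is a random vector $X$ taking values in $\mathbb{R}^n$. A payoff function is a measurable function $f:\mathbb{R}^n\to\mathbb{R}$ which is bounded from above (so expectations $Ef(a+dX)$ exist in $[-\infty,\infty)$). For $d>0$, $g_{X,f}(d):=\sup_{a\in\mathbb{R}^n}Ef(a+dX)$. The pair $(X,f)$ is reasonable if $g_{X,f}(d)$ is decreasing (i.e. non-increasing) in $d\in(0,\infty)$. The dart $X$ is reasonable if $(X,f)$ is reasonable for all payoff functions $f$. A random vector $X$ divides a random vector $Y$, written $X|Y$, if there exists a random vector $Z$ such that, if $Z$ and $X$ are independent, then $X+Z$ and $Y$ have the same distribution. A random vector $X$ is selfdecomposable if $X|dX$ for all $d>1$. *)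

(* Defs.v *)
(* Random vectors are random variables valued in 'rV[R]_n, which is given its
   Borel sigma-algebra (matrices carry the product topology). *)
From HB Require Import structures.
From mathcomp Require Import all_boot all_order all_algebra.
From mathcomp Require Import all_classical all_reals all_analysis.

Set Implicit Arguments.
Unset Strict Implicit.
Unset Printing Implicit Defensive.

Import Order.TTheory GRing.Theory Num.Theory.
Import numFieldNormedType.Exports.

Local Open Scope classical_set_scope.
Local Open Scope ring_scope.

Section borel_matrix.
Variables (R : realType) (m n : nat).

Let borel : set (set 'M[R]_(m, n)) := <<s @open 'M[R]_(m, n) >>.

Let borel0 : borel set0.
Proof. exact: sigma_algebra0. Qed.

Let borelC A : borel A -> borel (~` A).
Proof. exact: sigma_algebraC. Qed.

Let borelU (F : (set 'M[R]_(m, n))^nat) :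
  (forall i, borel (F i)) -> borel (\bigcup_i F i).
Proof. exact: sigma_algebra_bigcup. Qed.

HB.instance Definition _ := @isMeasurable.Build
  (sigma_display (@open 'M[R]_(m, n))) 'M[R]_(m, n) borel borel0 borelC borelU.

End borel_matrix.

Section darts.
Variables (R : realType) (n : nat).

Definition payoff (f : 'rV[R]_n -> R) : Prop :=
  measurable_fun setT f /\ has_ubound (range f).

(* The expectation is extended-real valued; for a payoff function the integral
   of the positive part is finite, so it lies in [-oo, +oo[. *)
Definition gain (dT : measure_display) (T : measurableType dT)
    (P : probability T R) (X : {RV P >-> 'rV[R]_n}) (f : 'rV[R]_n -> R)
    (d : R) : \bar R :=
  ereal_sup (range (fun a : 'rV[R]_n => 'E_P[fun w => f (a + d *: X w)%R])%E).

Definition reasonable_pair (dT : measure_display) (T : measurableType dT)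
    (P : probability T R) (X : {RV P >-> 'rV[R]_n}) (f : 'rV[R]_n -> R) : Prop :=
  forall s t : R, 0 < s -> s <= t -> (gain X f t <= gain X f s)%E.

Definition reasonable (dT : measure_display) (T : measurableType dT)
    (P : probability T R) (X : {RV P >-> 'rV[R]_n}) : Prop :=
  forall f : 'rV[R]_n -> R, payoff f -> reasonable_pair X f.

(* Stated for plain functions so that it applies directly to sums and multiples
   of random vectors, which are measurable. *)
Definition same_law (dT dT' : measure_display) (T : measurableType dT)
    (T' : measurableType dT') (P : probability T R) (Q : probability T' R)
    (X : T -> 'rV[R]_n) (Y : T' -> 'rV[R]_n) : Prop :=
  forall A : set 'rV[R]_n, measurable A -> P (X @^-1` A) = Q (Y @^-1` A).

Definition independent (dT : measure_display) (T : measurableType dT)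
    (P : probability T R) (X Y : T -> 'rV[R]_n) : Prop :=
  forall A B : set 'rV[R]_n, measurable A -> measurable B ->
    P (X @^-1` A `&` Y @^-1` B) = (P (X @^-1` A) * P (Y @^-1` B))%E.

(* Divisibility only concerns laws: the space carrying X need not carry a Z
   independent of X, so Z is taken together with a copy X' of X on some
   probability space. *)
Definition divides (dT dT' : measure_display) (T : measurableType dT)
    (T' : measurableType dT') (P : probability T R) (Q : probability T' R)
    (X : T -> 'rV[R]_n) (Y : T' -> 'rV[R]_n) : Prop :=
  exists (dS : measure_display) (S : measurableType dS) (M : probability S R)
         (X' Z : {RV M >-> 'rV[R]_n}),
    [/\ same_law M P X' X, independent M X' Z &
        same_law M Q (fun w => X' w + Z w) Y].

Definition selfdecomposable (dT : measure_display) (T : measurableType dT)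
    (P : probability T R) (X : {RV P >-> 'rV[R]_n}) : Prop :=
  forall d : R, 1 < d -> divides P P X (fun w => d *: X w).

End darts.

(* Main.v *)
Require Import Defs.
From HB Require Import structures.
From mathcomp Require Import all_boot all_order all_algebra.
From mathcomp Require Import all_classical all_reals all_analysis.
From mathcomp Require Import measurable_realfun lra.

Set Implicit Arguments.
Unset Strict Implicit.
Unset Printing Implicit Defensive.

Import Order.TTheory GRing.Theory Num.Theory.
Import numFieldNormedType.Exports.

Local Open Scope classical_set_scope.
Local Open Scope ring_scope.

(** If X' + Z has the law of d X, with X' and Z independent and X' distributed
    as X, then throwing the dart d s X at a is the same as first drawing the aim
    a + s Z and then throwing an independent dart s X' at it:
    E f(a + d s X) = E f((a + s Z) + s X').  Conditionally on Z, the expected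
    payoff is at most the supremum g(s) over all aims, hence so is the average
    over Z.  Taking the supremum over a gives g(d s) <= g(s)
    ([gain_le_of_divides]); selfdecomposability provides this for every ratio
    d = t / s > 1.

    Conditioning on Z is Tonelli's theorem for the joint law of (X', Z), which
    independence identifies with the product of the two laws
    ([ge0_integral_independent]).  A payoff is bounded above by some C but may
    have expectation -oo, so the argument is run on the nonnegative loss
    C - f, using E f = C - E (C - f) ([expectation_ubound]).

    Tonelli's theorem requires (x, z) |-> f(a + s (x + z)) to be measurable for
    the product of the Borel sigma-algebras, which is not what continuity of
    addition says directly: it gives measurability for the Borel sigma-algebra
    of the product space.  Measurability into matrices is therefore
    reduced to measurability of each coordinate ([measurable_fun_mx]), where
    sums of real functions are available. *)

(** * Borel measurability of matrix-valued functions *)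

Lemma measurable_fun_coord (R : realType) (m n : nat) (i : 'I_m) (j : 'I_n) :
  measurable_fun setT (fun A : 'M[R]_(m, n) => A i j).
Proof.
apply: (measurability (@RGenOpens.G R)) => [|_ [_ [x [y ->]] <-]].
  exact: RGenOpens.measurableE.
rewrite setTI; apply: sub_sigma_algebra.
apply: open_comp; last exact: interval_open.
by move=> A _; exact: coord_continuous.
Qed.

(** Sup-norm balls with rational centre and radius 1 / (k + 1): a countable base
    of the topology, indexed by a countable type. *)
Definition rat_box (R : realType) (m n : nat) (p : 'M[rat]_(m, n) * nat) :
    set 'M[R]_(m, n) :=
  [set A | forall i j, ball (ratr (p.1 i j) : R) p.2.+1%:R^-1 (A i j)].

Lemma open_rat_box (R : realType) (m n : nat) (U : set 'M[R]_(m, n))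
    (A : 'M[R]_(m, n)) : open U -> U A ->
  exists p, rat_box p A /\ rat_box p `<=` U.
Proof.
move=> oU UA; have /nbhs_ballP[e /= e0 AeU] : nbhs A U by exact: open_nbhs_nbhs.
(* A box of radius at most e / 2 that contains A lies in the ball of radius e
   around A. *)
have e20 : 0 < e / 2 by rewrite divr_gt0.
have [k ke] : exists k : nat, k.+1%:R^-1 < e / 2 :> R.
  have [k _ ke] := near_infty_natSinv_lt (PosNum e20).
  by exists k; exact: (ke k (leqnn k)).
have k0 : 0 < k.+1%:R^-1 :> R by rewrite invr_gt0.
have /(_ _ _)/cid q_ i j : exists q : rat, ball (ratr q : R) k.+1%:R^-1 (A i j).
  have [|q] := @rat_in_itvoo R (A i j - k.+1%:R^-1) (A i j + k.+1%:R^-1).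
    by rewrite ltrBlDr -addrA ltrDl addr_gt0.
  rewrite in_itv /= => /andP[q1 q2]; exists q.
  by rewrite /ball /= ltr_distl q1 q2.
exists (\matrix_(i, j) sval (q_ i j), k); split=> [i j|B kB].
  by rewrite /= mxE; case: (q_ i j).
apply: AeU; split=> // i j; rewrite (splitr e).
apply: (@ball_triangle _ _ (ratr (sval (q_ i j)) : R)).
  by apply: ball_sym; apply: le_ball (svalP (q_ i j)); exact: ltW.
by have := kB i j; rewrite /= mxE; apply: le_ball; exact: ltW.
Qed.

(** An open set is the union of the countably many rational boxes it contains,
    and the preimage of a box is a finite intersection of coordinate
    conditions. *)
Lemma measurable_fun_mx (R : realType) (m n : nat) (d : measure_display)
    (S : measurableType d) (g : S -> 'M[R]_(m, n)) :
  (forall i j, measurable_fun setT (fun w => g w i j)) ->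
  measurable_fun setT g.
Proof.
move=> mg; apply: (measurability (@open 'M[R]_(m, n))) => // _ [U oU <-].
rewrite setTI.
have -> : g @^-1` U = \bigcup_(p : 'M[rat]_(m, n) * nat)
    if `[< rat_box p `<=` U >] then g @^-1` (@rat_box R m n p) else set0.
  apply/seteqP; split=> w.
    move=> /(open_rat_box oU)[p [pw pU]]; exists p => //=.
    by case: asboolP.
  by case=> p _; case: asboolP => // pU; exact: pU.
apply: countable_bigcupT_measurable => [|p]; first exact: countableP.
case: ifP => // _.
have -> : g @^-1` (@rat_box R m n p) = \bigcap_(ij : 'I_m * 'I_n)
    (fun w => g w ij.1 ij.2) @^-1` ball (ratr (p.1 ij.1 ij.2) : R) p.2.+1%:R^-1.
  apply/seteqP; split=> w pw; first by move=> [i j] _; exact: pw.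
  by move=> i j; exact: (pw (i, j)).
apply: fin_bigcap_measurable => // ij _.
rewrite -[X in measurable X]setTI; apply: mg => //.
exact: measurable_ball.
Qed.

Lemma measurable_fun_addmx (R : realType) (m n : nat) (d : measure_display)
    (S : measurableType d) (g h : S -> 'M[R]_(m, n)) :
  measurable_fun setT g -> measurable_fun setT h ->
  measurable_fun setT (fun w => g w + h w).
Proof.
move=> mg mh; apply: measurable_fun_mx => i j.
under eq_fun do rewrite mxE.
apply: measurable_funD.
  exact: (measurableT_comp (measurable_fun_coord i j) mg).
exact: (measurableT_comp (measurable_fun_coord i j) mh).
Qed.

Lemma measurable_fun_affine (R : realType) (m n : nat) (a : 'M[R]_(m, n))
    (s : R) : measurable_fun setT (fun x : 'M[R]_(m, n) => a + s *: x).
Proof.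
apply: measurable_fun_mx => i j.
under eq_fun do rewrite !mxE.
apply: measurable_funD => //; apply: measurable_funM => //.
exact: measurable_fun_coord.
Qed.

(** * Integration against laws and joint laws *)

Lemma ge0_integral_same_law (R : realType) (n : nat) (d d' : measure_display)
    (T : measurableType d) (T' : measurableType d') (P : probability T R)
    (Q : probability T' R) (X : T -> 'rV[R]_n) (Y : T' -> 'rV[R]_n)
    (h : 'rV[R]_n -> \bar R) :
  measurable_fun setT X -> measurable_fun setT Y -> same_law P Q X Y ->
  measurable_fun setT h -> (forall x, 0 <= h x)%E ->
  (\int[P]_w h (X w) = \int[Q]_w h (Y w))%E.
Proof.
move=> mX mY XY mh h0.
have <- := @ge0_integral_pushforward _ _ _ _ _ X mX P setT h measurableT mh
  (fun x _ => h0 x).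
have <- := @ge0_integral_pushforward _ _ _ _ _ Y mY Q setT h measurableT mh
  (fun x _ => h0 x).
by apply: eq_measure_integral => A mA _; exact: XY.
Qed.

(** Both variables on the right range over the same probability space, so that
    only the marginal laws of X and Z enter.  The joint law of (X, Z) agrees with
    the product of the marginals on rectangles by independence, hence
    everywhere. *)
Lemma ge0_integral_independent (R : realType) (n : nat) (d : measure_display)
    (S : measurableType d) (M : probability S R) (X Z : {RV M >-> 'rV[R]_n})
    (h : 'rV[R]_n * 'rV[R]_n -> \bar R) :
  independent M X Z ->
  measurable_fun setT h -> (forall p, 0 <= h p)%E ->
  (\int[M]_w h (X w, Z w) = \int[M]_w \int[M]_v h (X v, Z w))%E.
Proof.
move=> XZ mh h0.
have mX : measurable_fun setT X by exact: measurable_funP.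
have mZ : measurable_fun setT Z by exact: measurable_funP.
have mXZ := measurable_fun_pair mX mZ.
have <- := @ge0_integral_pushforward _ _ _ _ _ _ mXZ M setT h measurableT mh
  (fun p _ => h0 p).
rewrite (@eq_measure_integral _ _ _ setT
  (distribution M X \x distribution M Z)%E); last first.
  move=> A mA _; apply/esym; apply: product_measure_unique mA.
  by move=> B C mB mC; exact: XZ.
rewrite fubini_tonelli2 // ge0_integral_distribution //.
- apply: eq_integral => w _ /=; rewrite /fubini_G ge0_integral_distribution //.
  exact: measurable_fun_pair1 mh.
- exact: measurable_fun_fubini_tonelli_G.
- by move=> z; apply: integral_ge0.
Qed.

(** With G the extended-real version of g, C - g + G^+ = C + G^- pointwise, an
    identity between nonnegative functions that can be integrated termwise.
    Since 0 <= C, also G^+ <= C, so the integral of G^+ is finite and can be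
    moved across even when the integral of G^- is infinite. *)
Lemma expectation_ubound (R : realType) (d : measure_display)
    (T : measurableType d) (P : probability T R) (C : R) (g : T -> R) :
  0 <= C -> measurable_fun setT g -> (forall w, g w <= C) ->
  ('E_P[g] = C%:E - \int[P]_w (C - g w)%:E)%E.
Proof.
move=> C0 mg gC; rewrite unlock integralE.
set G := fun w => (g w)%:E.
have mG : measurable_fun setT G by exact/measurable_EFinP.
have Gpos : (\int[P]_w G^\+ w <= C%:E)%E.
  rewrite -[leRHS]mule1 -(@probability_setT _ _ _ P) -integral_cst //.
  apply: ge0_le_integral => // [|w _]; first exact: measurable_funepos.
  by rewrite funeposE ge_max !lee_fin gC C0.
have Gpos_fin : (\int[P]_w G^\+ w)%E \is a fin_num.
  rewrite ge0_fin_numE; first exact: le_lt_trans Gpos (ltry _).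
  by apply: integral_ge0 => w _; exact: funepos_ge0.
have CG : (\int[P]_w (C - g w)%:E + \int[P]_w G^\+ w =
           C%:E + \int[P]_w G^\- w)%E.
  rewrite -ge0_integralD //; last 3 first.
  - by move=> w _; rewrite lee_fin subr_ge0.
  - by apply/measurable_EFinP; exact: measurable_funB.
  - exact: measurable_funepos.
  rewrite -[X in _ = (X + _)%E]mule1 -(@probability_setT _ _ _ P).
  rewrite -integral_cst // -ge0_integralD //; last exact: measurable_funeneg.
  apply: eq_integral => w _; rewrite funeposE funenegE /G -EFinN.
  have [g0|/ltW g0] := leP 0 (g w).
    by rewrite max_l ?max_r ?lee_fin ?oppr_le0 // -!EFinD; congr (_%:E); lra.
  by rewrite max_r ?max_l ?lee_fin ?oppr_ge0 // -!EFinD; congr (_%:E); lra.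
move: Gpos_fin CG.
have : (0 <= \int[P]_w (C - g w)%:E)%E.
  by apply: integral_ge0 => w _; rewrite lee_fin subr_ge0.
have : (0 <= \int[P]_w G^\- w)%E.
  by apply: integral_ge0 => w _; exact: funeneg_ge0.
case: (\int[P]_w G^\+ w)%E => [p||] //.
case: (\int[P]_w G^\- w)%E => [q||] //;
  case: (\int[P]_w (C - g w)%:E)%E => [r||] // _ _ _ [].
by move=> rpq; rewrite -!EFinB; congr (_%:E); lra.
Qed.

(** * The gain of a dart that divides its dilation *)

(** The supremum over aims turns into a lower bound C - gain X f s for the
    expected loss of a dart s X at any aim, valid even when the gain is -oo.
    The expected loss of d s X aimed at a is an average of such losses,
    over the random aim a + s Z. *)
Lemma gain_le_of_divides (R : realType) (n : nat) (dT : measure_display)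
    (T : measurableType dT) (P : probability T R) (X : {RV P >-> 'rV[R]_n})
    (d s : R) (f : 'rV[R]_n -> R) :
  divides P P X (fun w => d *: X w) -> payoff f ->
  (gain X f (d * s) <= gain X f s)%E.
Proof.
move=> [dS [S [M [X' [Z [X'X indep sum_law]]]]]] [mf [C0 fC0]].
(* The bound is made nonnegative as [expectation_ubound] requires. *)
pose C : R := Num.max 0 C0.
have C_ge0 : 0 <= C by rewrite le_max lexx.
have fC x : f x <= C by rewrite le_max (fC0 (f x)) ?orbT //; exists x.
have mX : measurable_fun setT X by exact: measurable_funP.
have mX' : measurable_fun setT X' by exact: measurable_funP.
have mZ : measurable_fun setT Z by exact: measurable_funP.
have mfa a t : measurable_fun setT (fun x : 'rV[R]_n => f (a + t *: x)).
  exact: (measurableT_comp mf (measurable_fun_affine a t)).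
have mh a t : measurable_fun setT (fun x : 'rV[R]_n => (C - f (a + t *: x))%:E).
  by apply/measurable_EFinP; apply: measurable_funB.
have h_ge0 x : (0 <= (C - f x)%:E)%E by rewrite lee_fin subr_ge0.
have EX a t : ('E_P[fun w => f (a + t *: X w)%R] =
    C%:E - \int[P]_w (C - f (a + t *: X w))%:E)%E.
  by apply: expectation_ubound => //; exact: measurableT_comp (mfa a t) mX.
have gain_ge b : (C%:E - \int[P]_w (C - f (b + s *: X w))%:E <= gain X f s)%E.
  by rewrite -EX; apply: ereal_sup_ubound; exists b.
have gain_le_C : (gain X f s <= C%:E)%E.
  apply: ge_ereal_sup => _ [b _ <-]; rewrite EX.
  by rewrite -[leRHS]sube0 leeB // integral_ge0.
have loss_ge b : (C%:E - gain X f s <= \int[P]_w (C - f (b + s *: X w))%:E)%E.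
  have := gain_ge b; have : (0 <= \int[P]_w (C - f (b + s *: X w))%:E)%E.
    exact: integral_ge0.
  case: (gain X f s) => [g||]; case: (\int[P]_w _)%E => [l||] //=;
    rewrite ?leey ?leNye // -!EFinB !lee_fin; lra.
apply: ge_ereal_sup => _ [a _ <-]; rewrite EX.
have mh_sum : measurable_fun setT (fun p : 'rV[R]_n * 'rV[R]_n =>
    (C - f (a + s *: (p.1 + p.2)))%:E).
  apply: (measurableT_comp (mh a s)).
  exact: measurable_fun_addmx.
have -> : (\int[P]_w (C - f (a + (d * s) *: X w))%:E =
    \int[M]_w \int[M]_v (C - f (a + s *: (X' v + Z w)))%:E)%E.
  transitivity (\int[M]_w (C - f (a + s *: (X' w + Z w)))%:E)%E.
    under eq_integral => w _ do rewrite mulrC -scalerA.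
    apply/esym; apply: (ge0_integral_same_law _ _ sum_law (mh a s)) => //.
    - exact: measurable_fun_addmx.
    - have -> : (fun w => d *: X w) = (fun w => 0 + d *: X w).
        by apply/funext => w; rewrite add0r.
      exact: (measurableT_comp (measurable_fun_affine 0 d) mX).
  exact: (ge0_integral_independent indep mh_sum).
have : (C%:E - gain X f s <=
    \int[M]_w \int[M]_v (C - f (a + s *: (X' v + Z w)))%:E)%E.
  rewrite -[leLHS]mule1 -(@probability_setT _ _ _ M) -integral_cst //.
  apply: ge0_le_integral => // [w _||w _].
  - by rewrite /cst -(@subee _ C%:E) // leeB.
  - apply: (@measurable_fun_fubini_tonelli_G _ _ S S R M
      (fun p => (C - f (a + s *: (X' p.1 + Z p.2)))%:E)) => //.
    apply: (measurableT_comp (mh a s)).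
    by apply: measurable_fun_addmx; apply: measurableT_comp.
  - have -> : (\int[M]_v (C - f (a + s *: (X' v + Z w)))%:E =
        \int[P]_v (C - f (a + s *: Z w + s *: X v))%:E)%E.
      rewrite -(ge0_integral_same_law mX' mX X'X (mh (a + s *: Z w) s)) //.
      by apply: eq_integral => v _; rewrite scalerDr [s *: X' v + _]addrC addrA.
    exact: loss_ge.
move: gain_le_C; case: (gain X f s) => [g||];
  case: (\int[M]_w _)%E => [l||] //=;
  rewrite ?leey ?leNye // -?EFinB ?lee_fin; lra.
Qed.

Theorem theorem1p7 (R : realType) (n : nat) (dT : measure_display)
    (T : measurableType dT) (P : probability T R) (X : {RV P >-> 'rV[R]_n}) :
  (forall d : R, 1 < d -> divides P P X (fun w => d *: X w) ->
    forall f : 'rV[R]_n -> R, payoff f ->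
    forall s : R, 0 < s -> (gain X f (d * s) <= gain X f s)%E) /\
  (selfdecomposable X -> reasonable X).
Proof.
split=> [d _ dX f fP s _|Xself f fP s t s0 st]; first exact: gain_le_of_divides.
have [->|s_neq_t] := eqVneq s t; first exact: lexx.
have ts : 1 < t / s by rewrite ltr_pdivlMr // mul1r lt_neqAle s_neq_t.
rewrite -[in leLHS](divfK (lt0r_neq0 s0) t).
exact: gain_le_of_divides (Xself _ ts) fP.
Qed.
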